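(* Let $\Omega \subset \mathbb{R}^2$ be a bounded, open, connected set, $f:\Omega\to[0,1]$ a given image, ${\cal A}$ a linear operator, $\mu>0$, $\lambda>0$, $K\ge 1$, and consider, for $g\in L^2(\Omega)$, constants $c_1,\dots,c_K\in\mathbb{R}$ and functions $u_1,\dots,u_K$ on $\Omega$, the energy \[ E(u_i, c_i, g) = \mu\, \Phi(f, {\cal A}g) + \lambda \sum_{i=1}^K \int_{\Omega}(g-c_i)^2 u_i\,dx + \sum_{i=1}^K \int_{\Omega} |\nabla u_i|\, dx, \] subject to $\sum_{i=1}^K u_i(x) = 1$ and $u_i(x)\in\{0,1\}$ for all $x\in\Omega$. Assume the data fidelity term $\Phi(f, {\cal A}g)$ is convex and continuous in $g$. Then for fixed $c_i$ and $u_i$ there exists one and only one $g\in L^2(\Omega)$ which minimizes $E(u_i, c_i, g)$.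
   Context: Image segmentation model coupling a restoration data fidelity term $\Phi(f,{\cal A}g)$ (e.g. $\int_\Omega (f-{\cal A}g)^2dx$ for Gaussian noise, $\int_\Omega({\cal A}g - f\log({\cal A}g))dx$ for Poisson noise, $\int_\Omega|f-{\cal A}g|dx$ for impulsive noise) with the piecewise constant Mumford-Shah segmentation fidelity $\sum_i\int_\Omega (g-c_i)^2u_i\,dx$ and total variation regularization of the indicator functions $u_i$; ${\cal A}$ is a problem-related linear operator (identity or blurring operator).
   Formalization: The fixed functions u_i are additionally assumed (Borel) measurable with finite total variation on Ω; if some u_i had infinite total variation, E would be identically +∞ and uniqueness of g would fail. *)

(* Defs.v *)
From HB Require Import structures.
From mathcomp Require Import all_boot all_order all_algebra.
From mathcomp Require Import all_classical all_reals all_analysis.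
Set Implicit Arguments. Unset Strict Implicit. Unset Printing Implicit Defensive.
Import Order.TTheory GRing.Theory Num.Theory.
Import numFieldNormedType.Exports.
Local Open Scope classical_set_scope.
Local Open Scope ring_scope.

Definition leb2 (R : realType) := (@lebesgue_measure R \x @lebesgue_measure R)%E.

Definition L2 (R : realType) (Om : set (R * R)) (g : R * R -> R) : Prop :=
  measurable_fun Om g /\
  (\int[@leb2 R]_(x in Om) ((g x) ^+ 2)%:E < +oo)%E.

Definition TV_test (R : realType) (Om : set (R * R)) (p1 p2 : R * R -> R) : Prop :=
  (forall x, differentiable p1 x) /\ (forall x, differentiable p2 x) /\
  continuous (fun x => 'D_(1, 0) p1 x) /\ continuous (fun x => 'D_(0, 1) p1 x) /\
  continuous (fun x => 'D_(1, 0) p2 x) /\ continuous (fun x => 'D_(0, 1) p2 x) /\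
  (exists C : set (R * R), compact C /\ C `<=` Om /\
      (forall x, ~ C x -> p1 x = 0 /\ p2 x = 0)) /\
  (forall x, p1 x ^+ 2 + p2 x ^+ 2 <= 1).

(* total variation  \int_Om |grad u| dx  (distributional definition) *)
Definition TV (R : realType) (Om : set (R * R)) (u : R * R -> R) : \bar R :=
  ereal_sup [set r | exists p1 p2 : R * R -> R, TV_test Om p1 p2 /\
      r = (\int[@leb2 R]_(x in Om)
             (u x * ('D_(1, 0) p1 x + 'D_(0, 1) p2 x))%:E)%E].

Definition energy (R : realType) (Om : set (R * R)) (K : nat)
    (Phi : (R * R -> R) -> (R * R -> R) -> R)
    (A : (R * R -> R) -> (R * R -> R)) (f : R * R -> R) (mu lam : R)
    (u : 'I_K -> R * R -> R) (c : 'I_K -> R) (g : R * R -> R) : \bar R :=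
  ((mu * Phi f (A g))%:E
   + lam%:E * (\sum_(i < K) \int[@leb2 R]_(x in Om) (((g x - c i) ^+ 2) * u i x)%:E)
   + \sum_(i < K) TV Om (u i))%E.

(* Main.v *)
(* As exactly one [u i x] equals 1, the fidelity sum is the squared [L2] distance
   from [g] to [w = \sum_i c i * u i], so that, up to a finite constant, the energy
   is [J g = F g + lam * ||g - w||^2] with [F] convex and continuous.  [J] is bounded
   below, since a continuous convex function decreases at most linearly away from
   [w], and the parallelogram identity gives
   [J ((g + h) / 2) <= (J g + J h) / 2 - lam / 4 * ||g - h||^2].  Hence minimizing
   sequences are Cauchy, completeness of [L2] provides a minimizer, and two
   minimizers are at distance 0. *)

Require Import Defs.
From HB Require Import structures.
From mathcomp Require Import all_boot all_order all_algebra.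
From mathcomp Require Import all_classical all_reals all_analysis.
From mathcomp Require Import measurable_realfun ring lra.
Set Implicit Arguments.
Unset Strict Implicit.
Unset Printing Implicit Defensive.
Import Order.TTheory GRing.Theory Num.Theory.
Import numFieldNormedType.Exports.
Local Open Scope classical_set_scope.
Local Open Scope ring_scope.

(** * Measurability and finite area of bounded open sets in the plane *)

Lemma open_prod_measurable {R : realType} (U : set (R * R)) :
  open U -> measurable U.
Proof.
move=> oU.
(* Measurability refers to the product sigma-algebra, so [U] is written as a countable union of
   squares with rational centre and radius; triples whose square leaves [U] contribute [set0]. *)
pose B (p q r : rat) : set (R * R) :=
  ball (ratr p : R) (ratr r : R) `*` ball (ratr q : R) (ratr r : R).
suff -> : U = \bigcup_p \bigcup_q \bigcup_r
    if `[< B p q r `<=` U >] then B p q r else set0.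
  apply: bigcupT_measurable_rat => p; apply: bigcupT_measurable_rat => q.
  apply: bigcupT_measurable_rat => r; case: ifP => // _.
  by apply: measurableX; apply: open_measurable; exact: ball_open.
apply/seteqP; split=> [[x y] Uxy|z [p _ [q _ [r _]]]]; last first.
  by case: ifPn => // /asboolP; exact.
have /nbhs_ballP[e /= e0 eU] : nbhs (x, y) U by exact: open_nbhs_nbhs.
(* A square of radius below [e / 2] whose centre is within that radius of [(x, y)] contains [(x, y)]
   and stays inside its [e]-ball. *)
have [r] : exists r : R, (r \in `]0, e / 2[) /\ (@ratr R @` setT) r.
  have [||r [/= h1 h2]] := @dense_rat R `]0, e / 2[%classic.
  - by exists (e / 4); rewrite /= in_itv /=; apply/andP; split; lra.
  - exact: interval_open.
  - by exists r; split.
case; rewrite in_itv /= => /andP[r0 re] [r' _ rE]; rewrite -rE in r0 re.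
have approx (z : R) : exists p : rat, ball z (ratr r' : R) (ratr p : R).
  have [||p [/= h1 [q _ qp]]] := @dense_rat R (ball z (ratr r' : R)).
  - by exists z; exact: ballxx.
  - exact: ball_open.
  - by exists q; rewrite qp.
have [p xp] := approx x; have [q yq] := approx y.
exists p => //; exists q => //; exists r' => //.
case: ifPn => [_|/asboolP[]]; first by split; exact: ball_sym.
move=> [a b] [/= pa qb]; apply: eU; split => /=.
- by apply: (@le_ball _ _ x (ratr r' + ratr r')); [lra|exact: ball_triangle pa].
- by apply: (@le_ball _ _ y (ratr r' + ratr r')); [lra|exact: ball_triangle qb].
Qed.

(** The product carries the max norm, so a bounded set lies in a closed square, whose measure is a
    product of two interval lengths. *)
Lemma bounded_leb2_lty {R : realType} (U : set (R * R)) :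
  bounded_set U -> measurable U -> (@leb2 R U < +oo)%E.
Proof.
move=> [M [_ /(_ (Num.max M 0 + 1))]]; rewrite /globally /=.
have -> : (M < Num.max M 0 + 1) by rewrite ltr_pwDr// le_max lexx.
set N := Num.max M 0 + 1 => /(_ isT) UN mU.
pose I := [set` `[- N, N]] : set (measurableTypeR R).
have mI : measurable I by exact: measurable_itv.
have UI : U `<=` I `*` I.
  move=> [x y] /UN; rewrite prod_normE /= ge_max => /andP[xN yN].
  by split; rewrite /I /= in_itv /= -ler_norml.
apply: (@le_lt_trans _ _ (@leb2 R (I `*` I))).
  by apply: le_measure => //; rewrite inE//; exact: measurableX.
rewrite /leb2 product_measure1E//= lebesgue_measure_itv /=.
by case: ifP => _; rewrite ?mule0 // -EFinD -EFinM ltry.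
Qed.

(** * Square integrable functions and the squared norm *)

Definition square_integrable {d} {T : measurableType d} {R : realType}
    (mu : {measure set T -> \bar R}) (D : set T) (g : T -> R) : Prop :=
  measurable_fun D g /\ (\int[mu]_(x in D) ((g x) ^+ 2)%:E < +oo)%E.

(** Kept squared and real-valued: it is the true integral on square integrable functions, where
    [EFin_sqnorm] returns to the extended reals. For [leb2], [square_integrable] unfolds to [L2]. *)
Definition sqnorm {d} {T : measurableType d} {R : realType}
    (mu : {measure set T -> \bar R}) (D : set T) (g : T -> R) : R :=
  \int[mu]_(x in D) (g x ^+ 2).

Section SquareIntegrable.
Context {d} {T : measurableType d} {R : realType}.
Context (mu : {measure set T -> \bar R}) (D : set T) (mD : measurable D).
Local Notation L2mu := (square_integrable mu D).
Local Notation N := (sqnorm mu D).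
Implicit Types g h w : T -> R.

Lemma square_integrable_integrable g :
  L2mu g -> mu.-integrable D (EFin \o (fun x => g x ^+ 2)).
Proof.
move=> [mg ig]; apply/integrableP; split.
  by apply/measurable_EFinP; exact: measurable_funX.
under eq_integral do rewrite /= ger0_norm ?sqr_ge0//.
exact: ig.
Qed.

Lemma le_sqr_square_integrable g (G : T -> R) : measurable_fun D g ->
  mu.-integrable D (EFin \o G) -> (forall x, D x -> g x ^+ 2 <= G x) -> L2mu g.
Proof.
move=> mg iG gG; split=> //.
have /integrableP[_] : mu.-integrable D (EFin \o (fun x => g x ^+ 2)).
  apply: (le_integrable mD _ _ iG).
    by apply/measurable_EFinP; exact: measurable_funX.
  move=> x Dx /=; rewrite lee_fin ger0_norm ?sqr_ge0//.
  exact: le_trans (gG _ Dx) (ler_norm _).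
by under eq_integral do rewrite /= ger0_norm ?sqr_ge0//.
Qed.

Lemma bounded_square_integrable g (C : R) : (mu D < +oo)%E ->
  measurable_fun D g -> (forall x, D x -> g x ^+ 2 <= C) -> L2mu g.
Proof.
move=> Doo mg; apply: le_sqr_square_integrable => //.
apply/integrableP; split; first by apply/measurable_EFinP; exact: measurable_cst.
rewrite (integral_cst mu mD `|C%:E|%E) -ge0_fin_numE ?mule_ge0//.
by rewrite fin_numM// ge0_fin_numE.
Qed.

(** The majorant comes from the parallelogram law, dropping the term [(a * g x - b * h x) ^+ 2]. *)
Lemma square_integrable_lin (a b : R) g h :
  L2mu g -> L2mu h -> L2mu (fun x => a * g x + b * h x).
Proof.
move=> Lg Lh; have [mg _] := Lg; have [mh _] := Lh.
apply: (@le_sqr_square_integrable _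
  (fun x => 2 * a ^+ 2 * g x ^+ 2 + 2 * b ^+ 2 * h x ^+ 2)).
- by apply: measurable_funD; apply: measurable_funM => //; exact: measurable_cst.
- have iZ (r : R) f : L2mu f -> mu.-integrable D (fun x => (r * f x ^+ 2)%:E).
    move=> /square_integrable_integrable iF.
    by have := integrableZl mD r iF.
  have := integrableD mD (iZ (2 * a ^+ 2) _ Lg) (iZ (2 * b ^+ 2) _ Lh).
  by apply: eq_integrable => // x _; rewrite /= EFinD.
- by move=> x _; rewrite -subr_ge0; have := sqr_ge0 (a * g x - b * h x); nra.
Qed.

Lemma square_integrableB g h : L2mu g -> L2mu h -> L2mu (fun x => g x - h x).
Proof.
move=> Lg Lh; have := square_integrable_lin 1 (-1) Lg Lh.
by congr (square_integrable mu D _); apply/funext => x; ring.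
Qed.

Lemma sqnorm_ge0 g : 0 <= N g.
Proof. by apply: Rintegral_ge0 => x _; exact: sqr_ge0. Qed.

Lemma sqnormZ (a : R) g : L2mu g -> N (fun x => a * g x) = a ^+ 2 * N g.
Proof.
move=> /square_integrable_integrable ig; rewrite /sqnorm -RintegralZl//.
by apply: eq_Rintegral => x _; ring.
Qed.

Lemma sqnormBC g h : N (fun x => g x - h x) = N (fun x => h x - g x).
Proof. by apply: eq_Rintegral => x _; ring. Qed.

Lemma EFin_sqnorm g : L2mu g -> (N g)%:E = (\int[mu]_(x in D) (g x ^+ 2)%:E)%E.
Proof.
move=> Lg; rewrite /sqnorm /Rintegral fineK//.
apply: integrable_fin_num => //; exact: square_integrable_integrable.
Qed.

(** The identity already holds pointwise, for every real [t]. Its last term is the source of strong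
    convexity. *)
Lemma sqnorm_convex_comb (t : R) g h : L2mu g -> L2mu h ->
  N (fun x => t * g x + (1 - t) * h x) =
  t * N g + (1 - t) * N h - t * (1 - t) * N (fun x => g x - h x).
Proof.
move=> Lg Lh.
have ig := square_integrable_integrable Lg.
have ih := square_integrable_integrable Lh.
have iB := square_integrable_integrable (square_integrableB Lg Lh).
have iZ (r : R) (f : T -> R) : mu.-integrable D (EFin \o f) ->
    mu.-integrable D (EFin \o (fun x => r * f x)).
  by move=> iF; have := integrableZl mD r iF.
rewrite /sqnorm -!RintegralZl// -RintegralD//; [|exact: iZ|exact: iZ].
rewrite -RintegralB//; [|..|exact: iZ]; last first.
  have := integrableD mD (iZ t _ ig) (iZ (1 - t) _ ih).
  by apply: eq_integrable => // x _; rewrite /= EFinD.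
by apply: eq_Rintegral => x _; ring.
Qed.

Lemma sqnorm_eq0_ae g : L2mu g -> N g = 0 -> {ae mu, forall x, D x -> g x = 0}.
Proof.
move=> Lg Ng; have [mg _] := Lg.
have /(ae_eq_integral_abs mu mD) : measurable_fun D (fun x => (g x ^+ 2)%:E).
  by apply/measurable_EFinP; exact: measurable_funX.
case=> + _; under eq_integral do rewrite /= ger0_norm ?sqr_ge0//.
rewrite -EFin_sqnorm// Ng => /(_ erefl); apply: filterS => x /= g0 Dx.
by move: (g0 Dx) => [] /eqP; rewrite sqrf_eq0 => /eqP.
Qed.

End SquareIntegrable.

(** * Completeness, for sequences with a geometric Cauchy rate *)

Lemma measurable_fun_limn_einf {d} {T : measurableType d} {R : realType}
    (D : set T) (f : nat -> T -> \bar R) :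
  (forall n, measurable_fun D (f n)) ->
  measurable_fun D (fun x => limn_einf (f^~ x)).
Proof.
move=> mf; rewrite (_ : (fun _ => _) =
    (fun x => - limn_esup ((fun n x => - f n x) ^~ x))%E); last first.
  by apply/funext => x; rewrite -limn_einfN; congr limn_einf;
     apply/funext => n /=; rewrite oppeK.
apply: measurableT_comp; first exact: oppe_measurable.
by apply: measurable_fun_limn_esup => n; apply: measurableT_comp => //.
Qed.

Lemma limn_einf_le_ub {R : realType} (u : nat -> \bar R) (c : \bar R) :
  (forall n, u n <= c)%E -> (limn_einf u <= c)%E.
Proof.
move=> uc; rewrite limn_einf_lim; apply: lime_le; first exact: is_cvg_einfs.
apply: nearW => n; apply: ge_ereal_inf; exists (u n) => //.
by exists n => //=.
Qed.

Lemma cvgn_rapid {R : realType} (u : nat -> R) (C : R) :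
  (forall n, (4 ^+ n * (u n - u n.+1) ^+ 2) <= C) -> cvgn u.
Proof.
move=> uC; have C0 : 0 <= C by apply: le_trans (uC 0%N); rewrite mul1r sqr_ge0.
have -> : u = (series (telescope u) \+ cst (u 0%N)).
  by apply/funext => n; rewrite [LHS](eq_sum_telescope u) /= addrC.
apply: is_cvgD; last exact: is_cvg_cst.
(* With [x = 2 ^+ n * |u n - u n.+1|] the hypothesis reads [x ^+ 2 <= C], whence [x <= 1 + C]
   without a square root; a geometric series then dominates the telescoping one. *)
apply: normed_cvg; apply: (@series_le_cvg _ _ (geometric (1 + C) 2^-1)).
- by move=> n; exact: normr_ge0.
- by move=> n; apply: geometric_ge0; lra.
- move=> n; rewrite /geometric/telescope /= exprVn ler_pdivlMr ?exprn_gt0//.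
  rewrite -(ger0_norm (exprn_ge0 n (ler0n R 2))) -normrM.
  have := uC n; rewrite (_ : 4 = 2 ^+ 2 :> R); last by ring.
  rewrite exprAC -exprMn (mulrC (2 ^+ n)) -sqrrN -mulNr opprB.
  by case: ler0P => _; nra.
- by apply: is_cvg_geometric_series; rewrite ger0_norm; lra.
Qed.

Section Completeness.
Context {d} {T : measurableType d} {R : realType}.
Context (mu : {measure set T -> \bar R}) (D : set T) (mD : measurable D).
Local Notation L2mu := (square_integrable mu D).
Local Notation N := (sqnorm mu D).
Context (gn : nat -> T -> R).
Hypothesis Lgn : forall n, L2mu (gn n).
Hypothesis gn_cauchy : forall n k, (n <= k)%N ->
  N (fun x => gn n x - gn k x) <= 16^-1 ^+ n.

(* The weights 4 ^+ n turn the integrable sum of the weighted squared increments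
   into a pointwise geometric bound on the increments. *)
Lemma rapid_cauchy_L2_ae_cvg : {ae mu, forall x, D x -> cvgn (gn^~ x)}.
Proof.
pose f n x : \bar R := (4 ^+ n * (gn n x - gn n.+1 x) ^+ 2)%:E.
have f0 n x : (0 <= f n x)%E.
  by rewrite lee_fin; apply: mulr_ge0; [exact: exprn_ge0|exact: sqr_ge0].
have LB n : L2mu (fun x => gn n x - gn n.+1 x) by exact: square_integrableB.
have mf n : measurable_fun D (f n).
  apply/measurable_EFinP; apply: measurable_funM; first exact: measurable_cst.
  by apply: measurable_funX; have [] := LB n.
(* The rate [16^-1 ^+ n] beats the weight [4 ^+ n] and leaves the summable bound [4^-1 ^+ n]. *)
have intf n : (\int[mu]_(x in D) f n x <= (geometric 1 4^-1 n)%:E)%E.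
  have -> : (\int[mu]_(x in D) f n x)%E =
      ((4 ^+ n)%:E * \int[mu]_(x in D) ((gn n x - gn n.+1 x) ^+ 2)%:E)%E.
    rewrite -integralZl//; exact: square_integrable_integrable.
  rewrite -EFin_sqnorm// -EFinM lee_fin /geometric /= mul1r.
  apply: le_trans (ler_wpM2l (exprn_ge0 n (ler0n R 4)) (gn_cauchy (leqnSn n))) _.
  by rewrite -exprMn (_ : 4 * 16^-1 = 4^-1 :> R)//; field.
pose S x := (\sum_(0 <= n <oo) f n x)%E.
have S0 x : (0 <= S x)%E by apply: nneseries_ge0 => n _ _.
have iS : mu.-integrable D S.
  apply/integrableP; split.
    by apply: ge0_emeasurable_sum => // n x _ _.
  under eq_integral do rewrite gee0_abs//.
  rewrite integral_nneseries//.
  apply: (@le_lt_trans _ _ (1 / (1 - 4^-1))%:E); last exact: ltry.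
  apply: lime_le.
    by apply: is_cvg_nneseries => n _ _; exact: integral_ge0.
  apply: nearW => n; apply: (@le_trans _ _ (series (geometric 1 (4^-1 : R)) n)%:E).
    by rewrite /series /= -sumEFin; apply: lee_sum => i _; exact: intf.
  by rewrite lee_fin; apply: geometric_le_lim => //; rewrite ger0_norm; lra.
apply: filterS (integrable_ae mD iS) => x /= Sx Dx.
(* Integrability makes [S x] finite almost everywhere; it bounds each of its nonnegative terms,
   hence serves as the constant [C]. *)
apply: (@cvgn_rapid _ _ (fine (S x))) => n.
rewrite -lee_fin (fineK (Sx Dx)).
apply: le_trans (nneseries_lim_ge n.+1 _); last by move=> k _ _; exact: f0.
by rewrite big_nat_recr//= leeDr// sume_ge0.
Qed.

(** By Fatou: almost everywhere [(gn n - g) ^+ 2] is the lower limit in [k] of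
    [(gn n - gn (k + n)) ^+ 2], whose integrals are at most [16^-1 ^+ n]. *)
Lemma rapid_cauchy_L2_cvg :
  exists2 g, L2mu g & forall n, N (fun x => gn n x - g x) <= 16^-1 ^+ n.
Proof.
(* The upper limit is measurable without any convergence and agrees with the pointwise limit where
   that exists; [fine] gives 0 where it is infinite. *)
pose g x := fine (limn_esup (fun n => (gn n x)%:E)).
have mgn n : measurable_fun D (gn n) by have [] := Lgn n.
have mg : measurable_fun D g.
  apply: (measurableT_comp (fine_measurable measurableT)).
  apply: (@measurable_fun_limn_esup _ _ _ _ (fun n x => (gn n x)%:E)) => n.
  exact/measurable_EFinP.
have int_le n : (\int[mu]_(x in D) ((gn n x - g x) ^+ 2)%:E <= (16^-1 ^+ n)%:E)%E.
  (* The shift by [n] brings every [k] within reach of [gn_cauchy]. *)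
  pose f k x : \bar R := ((gn n x - gn (k + n)%N x) ^+ 2)%:E.
  have mf k : measurable_fun D (f k).
    by apply/measurable_EFinP/measurable_funX/measurable_funB.
  have -> : (\int[mu]_(x in D) ((gn n x - g x) ^+ 2)%:E =
             \int[mu]_(x in D) limn_einf (f^~ x))%E.
    apply: ae_eq_integral => //.
    - by apply/measurable_EFinP/measurable_funX/measurable_funB.
    - exact: measurable_fun_limn_einf.
    apply: filterS rapid_cauchy_L2_ae_cvg => x /= /[apply] cx.
    have -> : g x = limn (gn^~ x).
      rewrite /g; have cE : ((gn k x)%:E @[k --> \oo] --> (limn (gn^~ x))%:E)%E.
        by apply: cvg_EFin => //; exact: nearW.
      by rewrite (cvg_limn_einf_sup cE).
    apply/esym; have cE : f k x @[k --> \oo] --> ((gn n x - limn (gn^~ x)) ^+ 2)%:E.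
      apply: cvg_EFin; first exact: nearW.
      have h : gn (k + n)%N x @[k --> \oo] --> limn (gn^~ x).
        by rewrite (cvg_shiftn n (gn^~ x)).
      by apply: cvgM; apply: cvgB => //; exact: cvg_cst.
    by rewrite (cvg_limn_einf_sup cE).
  apply: le_trans (fatou mu mD mf _) _ => [k x _|].
    by rewrite lee_fin sqr_ge0.
  apply: limn_einf_le_ub => k.
  rewrite -EFin_sqnorm//; last exact: square_integrableB.
  by rewrite lee_fin gn_cauchy// leq_addl.
have LB n : L2mu (fun x => gn n x - g x).
  split; first exact: measurable_funB.
  exact: le_lt_trans (int_le n) (ltry _).
exists g => [|n]; last by rewrite -lee_fin EFin_sqnorm.
(* [g] is recovered as [gn 0 - (gn 0 - g)]. *)
have := square_integrableB mD (Lgn 0%N) (LB 0%N).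
by congr (square_integrable mu D _); apply/funext => x; ring.
Qed.

End Completeness.

(** * Minimizing a continuous convex functional plus a squared distance *)

Section StronglyConvex.
Context {d} {T : measurableType d} {R : realType}.
Context (mu : {measure set T -> \bar R}) (D : set T) (mD : measurable D).
Local Notation L2mu := (square_integrable mu D).
Local Notation N := (sqnorm mu D).
Implicit Types g h w : T -> R.

(* [g] is a convex combination, with weights [1 - e] and [e], of [g + h] and
   [g + (1 - e^-1) h]. *)
Lemma sqnormD_le (e : R) g h : 0 < e -> e <= 1 -> L2mu g -> L2mu h ->
  (1 - e) * N (fun x => g x + h x) <= N g + e^-1 * N h.
Proof.
move=> e0 e1 Lg Lh.
have LP : L2mu (fun x => 1 * g x + 1 * h x) by exact: square_integrable_lin.
have LQ : L2mu (fun x => 1 * g x + (1 - e^-1) * h x).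
  exact: square_integrable_lin.
have := sqnorm_convex_comb mD (1 - e) LP LQ.
have -> : (fun x => (1 - e) * (1 * g x + 1 * h x) +
    (1 - (1 - e)) * (1 * g x + (1 - e^-1) * h x)) = g.
  by apply/funext => x; field; rewrite gt_eqF.
have -> : (fun x => 1 * g x + 1 * h x - (1 * g x + (1 - e^-1) * h x)) =
    (fun x => e^-1 * h x) by apply/funext => x; ring.
have -> : (fun x => 1 * g x + 1 * h x) = (fun x => g x + h x).
  by apply/funext => x; ring.
rewrite sqnormZ//; set Q := N (fun x => 1 * g x + _).
have -> : (1 - e) * (1 - (1 - e)) * (e^-1 ^+ 2 * N h) = e^-1 * N h - N h.
  by field; rewrite gt_eqF.
move=> ->; have Q0 : 0 <= Q by exact: sqnorm_ge0.
by have := sqnorm_ge0 mu D h; nra.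
Qed.

Context (F : (T -> R) -> R).
Hypothesis convF : forall g h (t : R), L2mu g -> L2mu h -> 0 <= t <= 1 ->
  F (fun x => t * g x + (1 - t) * h x) <= t * F g + (1 - t) * F h.
Hypothesis contF : forall (gn : nat -> T -> R) g, (forall n, L2mu (gn n)) -> L2mu g ->
  (fun n => N (fun x => gn n x - g x)) @ \oo --> 0 ->
  (fun n => F (gn n)) @ \oo --> F g.

Context (w : T -> R) (Lw : L2mu w) (kappa : R) (kappa_gt0 : 0 < kappa).

(** Sequential continuity suffices: otherwise functions [gn n] at distance at most [2^-1 ^+ n] from
    [w] would satisfy [F (gn n) < F w - 1], although [F (gn n)] tends to [F w]. *)
Lemma convex_cvg_lbound_near : exists2 delta, 0 < delta &
  forall h, L2mu h -> N (fun x => h x - w x) <= delta ^+ 2 -> F w - 1 <= F h.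
Proof.
apply: contrapT => noD.
have /choice[gn gnP] : forall n, exists h, [/\ L2mu h,
    N (fun x => h x - w x) <= (2^-1 ^+ n) ^+ 2 & F h < F w - 1].
  move=> n; apply: contrapT => nh; apply: noD; exists (2^-1 ^+ n).
    by rewrite exprn_gt0// invr_gt0.
  move=> h Lh hN; rewrite leNgt; apply/negP => Fh; apply: nh; by exists h.
have cN : (fun n => N (fun x => gn n x - w x)) @ \oo --> 0.
  apply: (@squeeze_cvgr _ _ _ _ (cst 0) (geometric 1 (4^-1))).
  - apply: nearW => n; rewrite sqnorm_ge0 /=; have [_ + _] := gnP n.
    move=> /le_trans; apply.
    by rewrite mul1r exprAC (_ : 2^-1 ^+ 2 = 4^-1 :> R)//; field.
  - exact: cvg_cst.
  - by apply: cvg_geometric; rewrite ger0_norm; lra.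
have Lgn n : L2mu (gn n) by have [] := gnP n.
have : F w <= F w - 1.
  apply: (cvgr_to_le (contF Lgn Lw cN)).
  by apply: nearW => n; have [_ _ /ltW] := gnP n.
by rewrite lerBrDr gerDl ler10.
Qed.

Local Definition J g := F g + kappa * N (fun x => g x - w x).

(* If [g] is at distance [r > delta] from [w], convexity along the segment from [w]
   to [g], tested at distance [delta] from [w], gives [F w - r / delta <= F g];
   the quadratic term absorbs this linear decrease. *)
Lemma strongly_convex_lbounded : exists m, forall g, L2mu g -> m <= J g.
Proof.
have [delta delta0 near_w] := convex_cvg_lbound_near.
(* The subtracted inverse is the maximum over [r] of [r / delta - kappa * r ^+ 2], attained at
   [r = (2 * kappa * delta)^-1]; [h3] and [h4] complete that square. *)
exists (F w - 1 - (4 * kappa * delta ^+ 2)^-1) => g Lg.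
have LB := square_integrableB mD Lg Lw.
rewrite /J; set q := N _; have q0 : 0 <= q by exact: sqnorm_ge0.
set i := (4 * kappa * delta ^+ 2)^-1.
have i0 : 0 <= i by rewrite invr_ge0 !mulr_ge0// ?sqr_ge0 ?ltW.
have [qd|dq] := leP q (delta ^+ 2).
  by have := near_w g Lg qd; have := mulr_ge0 (ltW kappa_gt0) q0; lra.
pose r := Num.sqrt q; have rq : q = r ^+ 2 by rewrite sqr_sqrtr.
have dr : delta < r by rewrite -ltr_sqr ?nnegrE ?sqrtr_ge0 ?ltW// -rq.
have r0 : 0 < r by exact: lt_trans dr.
have s01 : 0 <= delta / r <= 1.
  by apply/andP; split; [rewrite divr_ge0// ltW|rewrite ler_pdivrMr// mul1r ltW].
have Lh := square_integrable_lin mD (delta / r) (1 - delta / r) Lg Lw.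
have /(near_w _ Lh) Fh : N (fun x => delta / r * g x + (1 - delta / r) * w x - w x)
    <= delta ^+ 2.
  have -> : (fun x => delta / r * g x + (1 - delta / r) * w x - w x) =
      (fun x => delta / r * (g x - w x)) by apply/funext => x; ring.
  rewrite sqnormZ// -/q rq -exprMn divfK// gt_eqF//.
have Fg := convF Lg Lw s01.
have : - 1 <= delta / r * (F g - F w) by lra.
rewrite mulrAC ler_pdivlMr// mulN1r => h1.
have h2 : - (r / delta) <= F g - F w.
  by rewrite -mulNr ler_pdivrMr// mulrC.
have h3 : 0 <= kappa * (r - (2 * kappa * delta)^-1) ^+ 2.
  by rewrite mulr_ge0 ?sqr_ge0 ?ltW.
have h4 : kappa * (r - (2 * kappa * delta)^-1) ^+ 2 =
    kappa * r ^+ 2 - r / delta + i.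
  by rewrite /i; field; rewrite !gt_eqF.
by rewrite rq; lra.
Qed.

(** The factor [kappa / 4] is [kappa * t * (1 - t)] at [t = 2^-1]. Only the existence of such a
    competitor is recorded, since it is merely compared with a lower bound of [J]. *)
Lemma strongly_convex_midpoint g h : L2mu g -> L2mu h ->
  exists2 k, L2mu k & J k <= (J g + J h) / 2 - kappa / 4 * N (fun x => g x - h x).
Proof.
move=> Lg Lh; exists (fun x => 2^-1 * g x + (1 - 2^-1) * h x).
  exact: square_integrable_lin.
have F_le : F (fun x => 2^-1 * g x + (1 - 2^-1) * h x) <=
    2^-1 * F g + (1 - 2^-1) * F h by apply: convF => //; apply/andP; split; lra.
have := sqnorm_convex_comb mD 2^-1
  (square_integrableB mD Lg Lw) (square_integrableB mD Lh Lw).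
have -> : (fun x => g x - w x - (h x - w x)) = (fun x => g x - h x).
  by apply/funext => x; ring.
have -> : (fun x => 2^-1 * (g x - w x) + (1 - 2^-1) * (h x - w x)) =
    (fun x => 2^-1 * g x + (1 - 2^-1) * h x - w x) by apply/funext => x; ring.
by rewrite /J => ->; lra.
Qed.

Lemma strongly_convex_minimizer_exists :
  exists2 g, L2mu g & forall h, L2mu h -> J g <= J h.
Proof.
have [m0 m0P] := strongly_convex_lbounded.
pose m := inf (J @` [set g | L2mu g]).
have infJ : has_inf (J @` [set g | L2mu g]).
  by split; [exists (J w), w | exists m0 => _ [g Lg <-]; exact: m0P].
have mJ g : L2mu g -> m <= J g.
  by move=> Lg; apply: ge_inf; [case: infJ | exists g].
(* This tolerance makes the midpoint inequality yield exactly the rate [16^-1 ^+ n] for squared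
   distances. *)
have /choice[gn gnP] n : exists g, L2mu g /\ J g < m + kappa / 4 * 16^-1 ^+ n.
  have e0 : 0 < kappa / 4 * 16^-1 ^+ n.
    by rewrite mulr_gt0 ?divr_gt0 ?exprn_gt0 ?invr_gt0.
  by have [_ [g Lg <-] Jg] := inf_adherent e0 infJ; exists g.
have Lgn n : L2mu (gn n) by have [] := gnP n.
have e_le n k : (n <= k)%N -> 16^-1 ^+ k <= 16^-1 ^+ n :> R.
  by move=> nk; apply: ler_wiXn2l => //; lra.
have [||g Lg gn_g] := @rapid_cauchy_L2_cvg _ _ _ mu D mD gn => //.
  move=> n k nk; have [_ Jn] := gnP n; have [_ Jk] := gnP k.
  have [p /mJ Lp Jp] := strongly_convex_midpoint (Lgn n) (Lgn k).
  have := e_le _ _ nk; set a := N _ in Jp *.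
  have k4 : 0 < kappa / 4 by rewrite divr_gt0.
  by rewrite -(ler_pM2l k4); nra.
have c0 : (fun n => N (fun x => gn n x - g x)) @ \oo --> 0.
  apply: (@squeeze_cvgr _ _ _ _ (cst 0) (geometric 1 (16^-1))).
  - by apply: nearW => n; rewrite sqnorm_ge0 /= mul1r gn_g.
  - exact: cvg_cst.
  - by apply: cvg_geometric; rewrite ger0_norm; lra.
pose W := N (fun x => g x - w x).
(* The quadratic term passes to the limit through [sqnormD_le] with weight [e = 2^-1 ^+ n]. As
   [16^-1 ^+ n = e ^+ 4], the error [e^-1 * N (gn n - g)] is at most [e]. All errors together are at
   most [C * e], so [F (gn n) <= m + C * e - kappa * W]. *)
pose C := kappa * (2 + W).
suff Jg : J g <= m by exists g => // h /mJ; exact: le_trans.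
rewrite /J -/W -lerBrDr.
have cC : m + C * 2^-1 ^+ n - kappa * W @[n --> \oo] --> m - kappa * W.
  apply: cvgB; last exact: cvg_cst.
  rewrite -[X in _ --> X]addr0; apply: cvgD; first exact: cvg_cst.
  by apply: (@cvg_geometric _ C 2^-1); rewrite ger0_norm; lra.
apply: (ler_cvg_to (contF Lgn Lg c0) cC); apply: nearW => n.
have [_] := gnP n; rewrite /J.
have e0 : 0 < 2^-1 ^+ n :> R by rewrite exprn_gt0// invr_gt0.
have e1 : 2^-1 ^+ n <= 1 :> R by rewrite exprn_ile1//; lra.
have := sqnormD_le e0 e1 (square_integrableB mD (Lgn n) Lw)
  (square_integrableB mD Lg (Lgn n)).
have -> : (fun x => gn n x - w x + (g x - gn n x)) = (fun x => g x - w x).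
  by apply/funext => x; ring.
rewrite -/W (sqnormBC mu D g (gn n)) => h1.
have e16 : 16^-1 ^+ n = (2^-1 ^+ n) ^+ 4 :> R.
  by rewrite exprAC; congr (_ ^+ n); field.
have h2 : (2^-1 ^+ n)^-1 * N (fun x => gn n x - g x) <= 2^-1 ^+ n.
  rewrite ler_pdivrMl//; apply: le_trans (gn_g n) _; rewrite e16.
  by rewrite -expr2 ler_wiXn2l// ltW.
have h3 : 16^-1 ^+ n <= 2^-1 ^+ n :> R.
  by rewrite e16 -[leRHS]expr1 ler_wiXn2l// ltW.
set e := 2^-1 ^+ n in h1 h2 h3 *; set a := N _ in h1 *.
have h4 : kappa * ((1 - e) * W) <= kappa * (a + e) by rewrite ler_pM2l//; lra.
have h5 : kappa * 16^-1 ^+ n <= kappa * e by rewrite ler_pM2l.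
have h6 : 0 <= kappa * e by rewrite mulr_ge0 ?ltW.
by rewrite /C; lra.
Qed.

Lemma strongly_convex_minimizer_unique g1 g2 : L2mu g1 -> L2mu g2 ->
  (forall h, L2mu h -> J g1 <= J h) -> (forall h, L2mu h -> J g2 <= J h) ->
  {ae mu, forall x, D x -> g1 x = g2 x}.
Proof.
move=> Lg1 Lg2 min1 min2.
have [p Lp Jp] := strongly_convex_midpoint Lg1 Lg2.
have N0 : N (fun x => g1 x - g2 x) = 0.
  apply/eqP; rewrite eq_le sqnorm_ge0 andbT.
  have k4 : 0 < kappa / 4 by rewrite divr_gt0.
  rewrite -(pmulr_rle0 _ k4).
  by have := min1 _ Lp; have := min1 _ Lg2; have := min2 _ Lg1; lra.
have := sqnorm_eq0_ae mD (square_integrableB mD Lg1 Lg2) N0.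
by apply: filterS => x /= /[apply] /eqP; rewrite subr_eq0 => /eqP.
Qed.

End StronglyConvex.

(** * Reduction of the segmentation energy to the abstract functional *)

Lemma TV_ge0 {R : realType} (Om : set (R * R)) (v : R * R -> R) :
  (0 <= TV Om v)%E.
Proof.
(* The zero vector field is admissible, with compact support [set0], and contributes the value 0. *)
apply: ereal_sup_ubound; exists (cst 0), (cst 0); split.
  have dc (x : R * R) : differentiable (cst (0 : R)) x by exact: differentiable_cst.
  have cD (y : R * R) : continuous (fun x => 'D_y (cst (0 : R)) x).
    rewrite (_ : (fun x => _) = cst 0); first by move=> x; exact: cvg_cst.
    by apply/funext => x; exact: derive_cst.
  do 6 (split; first by []); split; last by move=> x /=; rewrite expr0n addr0.
  by exists set0; split; [exact: compact0|split].
by rewrite integral0_eq// => x _; rewrite !derive_cst addr0 mulr0.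
Qed.

(** The index [j] depends on [a] alone, so one [j] evaluates both [w x] and the fidelity sum at
    [x]. *)
Lemma one_hot_sum {R : realType} {K : nat} (a : 'I_K -> R) :
  (forall i, a i = 0 \/ a i = 1) -> \sum_(i < K) a i = 1 ->
  exists j, forall b : 'I_K -> R, \sum_(i < K) b i * a i = b j.
Proof.
move=> a01 a1; have a0 i : 0 <= a i by case: (a01 i) => ->.
have [j aj] : exists j, a j = 1.
  apply: contrapT => na; suff : \sum_(i < K) a i = 0.
    by rewrite a1 => /eqP; rewrite oner_eq0.
  apply: big1 => i _; case: (a01 i) => // ai.
  by exfalso; apply: na; exists i.
have /eqP : \sum_(k < K | k != j) a k = 0.
  by move: a1; rewrite (bigD1 j)//= aj => h; lra.
rewrite psumr_eq0// => /allP aN0.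
exists j => b; rewrite (bigD1 j)//= aj mulr1 big1 ?addr0// => i ij.
by have := aN0 i (mem_index_enum i); rewrite ij /= => /eqP ->; rewrite mulr0.
Qed.

Section Energy.
Context {R : realType} (Om : set (R * R)) {K : nat}.
Context (u : 'I_K -> R * R -> R) (c : 'I_K -> R).
Hypothesis mOm : measurable Om.
Hypothesis mu_ : forall i, measurable_fun Om (u i).
Hypothesis u_sum : forall x, Om x -> \sum_(i < K) u i x = 1.
Hypothesis u01 : forall i x, Om x -> u i x = 0 \/ u i x = 1.

Let w x := \sum_(i < K) c i * u i x.

Let measurable_w : measurable_fun Om w.
Proof. by apply: measurable_sum => i; exact: measurable_funM. Qed.

Lemma L2_piecewise_constant : (@leb2 R Om < +oo)%E -> L2 Om w.
Proof.
move=> Omoo; have h := @bounded_square_integrable _ _ _ (@leb2 R) Om mOm w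
  (\sum_(i < K) c i ^+ 2) Omoo measurable_w.
apply: h => x Omx.
have [j uE] := one_hot_sum (fun i => u01 i Omx) (u_sum Omx).
by rewrite /w uE (bigD1 j)//= lerDl; apply: sumr_ge0 => i _; exact: sqr_ge0.
Qed.

(** Nonnegative terms allow exchanging sum and integral; at each point both integrands equal
    [(g x - c j) ^+ 2] for the active label [j]. *)
Lemma sum_fidelity_sqnorm g : L2 Om w -> L2 Om g ->
  (\sum_(i < K) \int[@leb2 R]_(x in Om) (((g x - c i) ^+ 2) * u i x)%:E =
   (sqnorm (@leb2 R) Om (fun x => g x - w x))%:E)%E.
Proof.
move=> Lw Lg; have [mg _] := Lg.
have LB := @square_integrableB _ _ _ (@leb2 R) Om mOm g w Lg Lw.
rewrite (@EFin_sqnorm _ _ _ (@leb2 R) Om mOm _ LB).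
rewrite -ge0_integral_sum//; first last.
- by move=> i x Omx; rewrite lee_fin mulr_ge0 ?sqr_ge0//; case: (u01 i Omx) => ->.
- move=> i; apply/measurable_EFinP; apply: measurable_funM; last exact: mu_.
  by apply: measurable_funX; apply: measurable_funB => //; exact: measurable_cst.
apply: eq_integral => x; rewrite inE => Omx; rewrite sumEFin; congr (_%:E).
have [j uE] := one_hot_sum (fun i => u01 i Omx) (u_sum Omx).
by rewrite /w !uE.
Qed.

(** Finite total variations turn the last sum into a real constant, which cancels when two energies
    are compared. *)
Lemma energyE Phi A f (mu lam : R) g : L2 Om w -> L2 Om g ->
  (forall i, TV Om (u i) < +oo)%E ->
  energy Om Phi A f mu lam u c g =
  (mu * Phi f (A g) + lam * sqnorm (@leb2 R) Om (fun x => g x - w x) +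
   \sum_(i < K) fine (TV Om (u i)))%:E.
Proof.
move=> Lw Lg TVoo; rewrite /energy sum_fidelity_sqnorm// !EFinD EFinM -sumEFin.
congr (_ + _)%E; apply: eq_bigr => i _.
by rewrite fineK// ge0_fin_numE// TV_ge0.
Qed.

End Energy.

Theorem theorem1 (R : realType) (Om : set (R * R)) (K : nat)
    (Phi : (R * R -> R) -> (R * R -> R) -> R)
    (A : (R * R -> R) -> (R * R -> R)) (f : R * R -> R) (mu lam : R)
    (u : 'I_K -> R * R -> R) (c : 'I_K -> R) :
  bounded_set Om -> open Om -> connected Om ->
  (forall x, Om x -> 0 <= f x <= 1) ->
  (forall (a b : R) (g h : R * R -> R),
      A (fun x => a * g x + b * h x) = (fun x => a * A g x + b * A h x)) ->
  0 < mu -> 0 < lam -> (1 <= K)%N ->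
  (* convexity of g |-> Phi(f, A g) on L^2(Om) *)
  (forall (g h : R * R -> R) (t : R), L2 Om g -> L2 Om h -> 0 <= t <= 1 ->
      Phi f (A (fun x => t * g x + (1 - t) * h x))
        <= t * Phi f (A g) + (1 - t) * Phi f (A h)) ->
  (* continuity of g |-> Phi(f, A g) in the L^2(Om) norm *)
  (forall (gn : nat -> R * R -> R) (g : R * R -> R),
      (forall n, L2 Om (gn n)) -> L2 Om g ->
      (fun n => fine (\int[@leb2 R]_(x in Om) ((gn n x - g x) ^+ 2)%:E)%E) @ \oo --> 0 ->
      (fun n => Phi f (A (gn n))) @ \oo --> Phi f (A g)) ->
  (* fixed u_i : indicator functions of a partition, of bounded variation *)
  (forall i, measurable_fun Om (u i)) ->
  (forall i, (TV Om (u i) < +oo)%E) ->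
  (forall x, Om x -> \sum_(i < K) u i x = 1) ->
  (forall i x, Om x -> u i x = 0 \/ u i x = 1) ->
  (exists g, L2 Om g /\
     forall h, L2 Om h -> (energy Om Phi A f mu lam u c g <= energy Om Phi A f mu lam u c h)%E) /\
  (forall g1 g2, L2 Om g1 -> L2 Om g2 ->
     (forall h, L2 Om h -> (energy Om Phi A f mu lam u c g1 <= energy Om Phi A f mu lam u c h)%E) ->
     (forall h, L2 Om h -> (energy Om Phi A f mu lam u c g2 <= energy Om Phi A f mu lam u c h)%E) ->
     {ae @leb2 R, forall x, Om x -> g1 x = g2 x}).
Proof.
move=> bOm oOm _ _ _ mu0 lam0 _ convPhi contPhi mu_ TVoo u_sum u01.
have mOm := open_prod_measurable oOm.
have Lw := L2_piecewise_constant c mOm mu_ u_sum u01 (bounded_leb2_lty bOm mOm).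
set w := (fun x => _) in Lw.
pose F g := mu * Phi f (A g).
have convF g h (t : R) : L2 Om g -> L2 Om h -> 0 <= t <= 1 ->
    F (fun x => t * g x + (1 - t) * h x) <= t * F g + (1 - t) * F h.
  move=> Lg Lh t01; rewrite /F (mulrCA t) (mulrCA (1 - t)) -mulrDr ler_pM2l//.
  exact: convPhi.
(* [sqnorm] unfolds to the [fine] of the integral in the continuity hypothesis, so [contPhi] applies
   as it stands. *)
have contF (gn : nat -> R * R -> R) g : (forall n, L2 Om (gn n)) -> L2 Om g ->
    (fun n => sqnorm (@leb2 R) Om (fun x => gn n x - g x)) @ \oo --> 0 ->
    (fun n => F (gn n)) @ \oo --> F g.
  by move=> Lgn Lg c0; apply: cvgMr; exact: contPhi.
have energy_le g h : L2 Om g -> L2 Om h ->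
    (energy Om Phi A f mu lam u c g <= energy Om Phi A f mu lam u c h)%E =
    (F g + lam * sqnorm (@leb2 R) Om (fun x => g x - w x) <=
     F h + lam * sqnorm (@leb2 R) Om (fun x => h x - w x)).
  move=> Lg Lh; rewrite !(@energyE _ _ _ _ _ mOm mu_ u_sum u01)//.
  by rewrite lee_fin lerD2r.
split.
  have [g Lg gmin] := @strongly_convex_minimizer_exists _ _ _ (@leb2 R) Om mOm
    F convF contF w Lw lam lam0.
  by exists g; split=> // h Lh; rewrite energy_le//; exact: gmin.
move=> g1 g2 Lg1 Lg2 min1 min2.
apply: (@strongly_convex_minimizer_unique _ _ _ (@leb2 R) Om mOm
  F convF w Lw lam lam0) => // h Lh.
- by have := min1 _ Lh; rewrite energy_le.
- by have := min2 _ Lh; rewrite energy_le.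
Qed.
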